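(* Let $(H,\mu_H,\Delta_H,\alpha_H)$ be a Hom-bialgebra over a field $k$ and $(D,\mu_D,\alpha_D)$ an $H$-bimodule Hom-algebra, with actions $h\otimes d\mapsto h\cdot d$ and $d\otimes h\mapsto d\cdot h$, and assume that $\alpha_D$ and $\alpha_H$ are both bijective. Define linear maps $$R:H\otimes D\to D\otimes H,\quad R(h\otimes d)=\alpha_H^{-2}(h_1)\cdot\alpha_D^{-1}(d)\otimes\alpha_H^{-1}(h_2),$$ $$Q:D\otimes H\to D\otimes H,\quad Q(d\otimes h)=\alpha_D^{-1}(d)\cdot\alpha_H^{-2}(h_2)\otimes\alpha_H^{-1}(h_1),$$ for $d\in D$, $h\in H$. Then $R$ and $Q$ define a Hom-L-R-twisted tensor product $D\,{}_Q\otimes_R H$ (denoted $D\natural H$, with $d\otimes h$ written $d\natural h$). Its structure map is $\alpha_D\otimes\alpha_H$ and its multiplication is $$(d\natural h)(d'\natural h')=[\alpha_D^{-1}(d)\cdot\alpha_H^{-2}(h'_2)][\alpha_H^{-2}(h_1)\cdot\alpha_D^{-1}(d')]\natural\alpha_H^{-1}(h_2h'_1).$$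
   Context: Everything is over a field $k$; (co)algebras are not assumed (co)unital. Sweedler notation $\Delta(h)=h_1\otimes h_2$. A Hom-associative algebra is a triple $(A,\mu,\alpha)$ with $\mu:A\otimes A\to A$ (written $aa'$) and $\alpha:A\to A$ linear (the structure map) such that $\alpha(aa')=\alpha(a)\alpha(a')$ and $\alpha(a)(a'a'')=(aa')\alpha(a'')$. A Hom-bialgebra $(H,\mu,\Delta,\alpha)$ is a Hom-associative algebra $(H,\mu,\alpha)$ with a linear map $\Delta:H\to H\otimes H$ such that $\Delta(h_1)\otimes\alpha(h_2)=\alpha(h_1)\otimes\Delta(h_2)$, $\Delta(hh')=h_1h'_1\otimes h_2h'_2$, $\Delta(\alpha(h))=\alpha(h_1)\otimes\alpha(h_2)$. For a Hom-associative algebra $A$ and a vector space $M$ with a linear map $\alpha_M:M\to M$: a left $A$-module structure is a linear map $a\otimes m\mapsto a\cdot m$ with $\alpha_M(a\cdot m)=\alpha_A(a)\cdot\alpha_M(m)$, $\alpha_A(a)\cdot(a'\cdot m)=(aa')\cdot\alpha_M(m)$; a right $A$-module structure is a linear map $m\otimes a\mapsto m\cdot a$ with $\alpha_M(m\cdot a)=\alpha_M(m)\cdot\alpha_A(a)$, $(m\cdot a)\cdot\alpha_A(a')=\alpha_M(m)\cdot(aa')$; an $A$-bimodule is both, with $\alpha_A(a)\cdot(m\cdot a')=(a\cdot m)\cdot\alpha_A(a')$. An $H$-bimodule Hom-algebra is a Hom-associative algebra $(D,\mu_D,\alpha_D)$ such that $(D,\alpha_D)$ is an $H$-bimodule and,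 for all $h\in H$, $d,d'\in D$: $\alpha_H^2(h)\cdot(dd')=(h_1\cdot d)(h_2\cdot d')$ and $(dd')\cdot\alpha_H^2(h)=(d\cdot h_1)(d'\cdot h_2)$. Hom-L-R-twisted tensor product $A\,{}_Q\otimes_R B$ of Hom-associative algebras $A$, $B$: linear maps $R:B\otimes A\to A\otimes B$, $R(b\otimes a)=a_R\otimes b_R=a_r\otimes b_r$, and $Q:A\otimes B\to A\otimes B$, $Q(a\otimes b)=a_Q\otimes b_Q=a_q\otimes b_q$ (Sweedler-type notation; different letters denote different applications of the same map) are required to satisfy for all $a,a'\in A$, $b,b'\in B$: (1) $\alpha_A(a_R)\otimes\alpha_B(b_R)=\alpha_A(a)_R\otimes\alpha_B(b)_R$; (2) $\alpha_A(a_Q)\otimes\alpha_B(b_Q)=\alpha_A(a)_Q\otimes\alpha_B(b)_Q$; (3) $(aa')_R\otimes\alpha_B(b)_R=a_Ra'_r\otimes\alpha_B((b_R)_r)$; (4) $\alpha_A(a)_R\otimes(bb')_R=\alpha_A((a_R)_r)\otimes b_rb'_R$; (5) $(aa')_Q\otimes\alpha_B(b)_Q=a_qa'_Q\otimes\alpha_B((b_Q)_q)$; (6) $\alpha_A(a)_Q\otimes(bb')_Q=\alpha_A((a_Q)_q)\otimes b_Qb'_q$; (7) $b_R\otimes(a_R)_Q\otimes b'_Q=b_R\otimes(a_Q)_R\otimes b'_Q$; (8) $a_R\otimes(b_R)_Q\otimes a'_Q=a_R\otimes(b_Q)_R\otimes a'_Q$; then $A\,{}_Q\otimes_RB$ is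 the Hom-associative algebra $A\otimes B$ with $(a\otimes b)(a'\otimes b')=a_Qa'_R\otimes b_Rb'_Q$ and structure map $\alpha_A\otimes\alpha_B$. *)

(* Defs.v *)
From HB Require Import structures.
From mathcomp Require Import all_boot all_algebra.
From mathcomp Require Import boolp.

Set Implicit Arguments.
Unset Strict Implicit.
Unset Printing Implicit Defensive.

Import GRing.Theory.
Local Open Scope ring_scope.
Local Open Scope quotient_scope.

Reserved Notation "u ⊗ v" (at level 40, left associativity).
Reserved Notation "U ⨂ V" (at level 40, left associativity).
Reserved Notation "\tsum_ ( x ⊗ y <- t ) E"
  (at level 41, x name, y name, t at level 50, E at level 41,
   format "'[' \tsum_ ( x  ⊗  y  <-  t ) '/  '  E ']'").

Notation bilin f := (bilinear_for *:%R *:%R f).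

(* The tensor product of arbitrary vector spaces: formal finite sums
   [:: (u_1, v_1); ...; (u_n, v_n)], standing for \sum_i u_i ⊗ v_i, modulo
   having the same value under every bilinear map. The universal property is
   given by tens_bilin, tsum_linear, tsum_tens and tensor_linear_ext below. *)
Section Tensor.
Variables (k : fieldType) (U V : lmodType k).

Definition teq : rel (seq (U * V)) := fun s s' =>
  `[< forall (W : lmodType k) (f : U -> V -> W), bilin f ->
        \sum_(p <- s) f p.1 p.2 = \sum_(p <- s') f p.1 p.2 >].

Lemma teq_refl : reflexive teq.
Proof. by move=> s; apply/asboolP. Qed.

Lemma teq_sym : symmetric teq.
Proof.
by move=> s s'; apply/asboolP/asboolP => e W f bf; rewrite (e W f bf).
Qed.

Lemma teq_trans : transitive teq.
Proof.
move=> s2 s1 s3 /asboolP e /asboolP e'; apply/asboolP => W f bf.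
by rewrite (e W f bf) (e' W f bf).
Qed.

Canonical teq_equiv := EquivRel teq teq_refl teq_sym teq_trans.

Definition tensor : Type := {eq_quot teq}.
HB.instance Definition _ := Choice.on tensor.
HB.instance Definition _ := EqQuotient.on tensor.

(* tsum f t is \sum_i f u_i v_i for a chosen expression t = \sum_i u_i ⊗ v_i;
   it does not depend on this expression when f is bilinear. *)
Definition tsum (W : nmodType) (f : U -> V -> W) (t : tensor) : W :=
  \sum_(p <- repr t) f p.1 p.2.

Definition tens (u : U) (v : V) : tensor := \pi_tensor [:: (u, v)].

Lemma tsum_pi (W : lmodType k) (f : U -> V -> W) (s : seq (U * V)) :
  bilin f -> tsum f (\pi_tensor s) = \sum_(p <- s) f p.1 p.2.
Proof.
move=> bf; rewrite /tsum.
have : \pi_tensor (repr (\pi_tensor s)) == \pi_tensor s by rewrite reprK.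
by rewrite eqmodE => /asboolP/(_ W f bf).
Qed.

Lemma tensorP (t t' : tensor) :
  (forall (W : lmodType k) (f : U -> V -> W), bilin f -> tsum f t = tsum f t') ->
  t = t'.
Proof.
move=> e; rewrite -[t]reprK -[t']reprK; apply/eqP; rewrite eqmodE.
by apply/asboolP => W f bf; apply: e.
Qed.

Definition tscale (a : k) (t : tensor) : tensor :=
  \pi_tensor [seq (a *: p.1, p.2) | p <- repr t].
Definition tadd (t t' : tensor) : tensor := \pi_tensor (repr t ++ repr t').
Definition tzero : tensor := \pi_tensor [::].
Definition topp (t : tensor) : tensor := tscale (-1) t.

Lemma tsum_scale (W : lmodType k) (f : U -> V -> W) a t :
  bilin f -> tsum f (tscale a t) = a *: tsum f t.
Proof.
move=> bf; rewrite tsum_pi// big_map scaler_sumr; apply: eq_bigr => p _ /=.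
have h := bf.1 p.2 a p.1 0.
have h0 := bf.1 p.2 (-1) 0 0.
by move: h h0 => /=; rewrite scaler0 !addr0 scaleN1r addNr => -> ->; rewrite addr0.
Qed.

Lemma tsum_add (W : lmodType k) (f : U -> V -> W) t t' :
  bilin f -> tsum f (tadd t t') = tsum f t + tsum f t'.
Proof. by move=> bf; rewrite tsum_pi// big_cat. Qed.

Lemma tsum_zero (W : lmodType k) (f : U -> V -> W) :
  bilin f -> tsum f tzero = 0.
Proof. by move=> bf; rewrite tsum_pi// big_nil. Qed.

Lemma taddA : associative tadd.
Proof. by move=> x y z; apply: tensorP => W f bf; rewrite !tsum_add// addrA. Qed.
Lemma taddC : commutative tadd.
Proof. by move=> x y; apply: tensorP => W f bf; rewrite !tsum_add// addrC. Qed.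
Lemma tadd0 : left_id tzero tadd.
Proof.
by move=> x; apply: tensorP => W f bf; rewrite tsum_add// tsum_zero// add0r.
Qed.
Lemma taddN : left_inverse tzero topp tadd.
Proof.
move=> x; apply: tensorP => W f bf.
by rewrite tsum_add// tsum_scale// tsum_zero// scaleN1r addNr.
Qed.

HB.instance Definition _ := GRing.isZmodule.Build tensor taddA taddC tadd0 taddN.

Lemma tscaleA a b t : tscale a (tscale b t) = tscale (a * b) t.
Proof. by apply: tensorP => W f bf; rewrite !tsum_scale// scalerA. Qed.
Lemma tscale1 : left_id 1 tscale.
Proof. by move=> t; apply: tensorP => W f bf; rewrite !tsum_scale// scale1r. Qed.
Lemma tscaleDr : right_distributive tscale +%R.
Proof.
move=> a t t'; apply: tensorP => W f bf.
by rewrite !(tsum_scale, tsum_add)// scalerDr.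
Qed.
Lemma tscaleDl t : {morph tscale^~ t : a b / a + b}.
Proof.
move=> a b; apply: tensorP => W f bf.
by rewrite !(tsum_scale, tsum_add)// scalerDl.
Qed.

HB.instance Definition _ := GRing.Zmodule_isLmodule.Build k tensor
  tscaleA tscale1 tscaleDr tscaleDl.

Lemma tsum_linear (W : lmodType k) (f : U -> V -> W) :
  bilin f -> linear (tsum f).
Proof.
by move=> bf a x y; rewrite [LHS]tsum_add// (tsum_scale a x bf).
Qed.

Lemma tsum_tens (W : lmodType k) (f : U -> V -> W) u v :
  bilin f -> tsum f (tens u v) = f u v.
Proof. by move=> bf; rewrite tsum_pi// big_seq1. Qed.

Lemma tens_bilin : bilin tens.
Proof.
split=> [v a x y|u a x y] /=; apply: tensorP => W f bf.
  by rewrite tsum_linear// !tsum_tens// bf.1.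
by rewrite tsum_linear// !tsum_tens// bf.2.
Qed.

Lemma tensE (t : tensor) : t = tsum tens t.
Proof.
apply: tensorP => W f bf.
pose g : {linear tensor -> W} :=
  HB.pack (tsum f) (GRing.isLinear.Build k tensor W *:%R (tsum f) (tsum_linear bf)).
rewrite -[RHS]/(g _) [X in g X]/tsum linear_sum /=.
by apply: eq_bigr => p _; rewrite tsum_tens.
Qed.

Lemma tensor_linear_ext (W : lmodType k) (f g : {linear tensor -> W}) :
  (forall u v, f (tens u v) = g (tens u v)) -> f =1 g.
Proof.
move=> e t; rewrite (tensE t) /tsum !linear_sum.
by apply: eq_bigr => p _; apply: e.
Qed.

End Tensor.

Notation "U ⨂ V" := (tensor U V).
Notation "u ⊗ v" := (tens u v) : ring_scope.
(* Sweedler-type notation: if t = \sum_i x_i ⊗ y_i, this is \sum_i E(x_i, y_i).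
   It is only used with E bilinear in x and y. *)
Notation "\tsum_ ( x ⊗ y <- t ) E" := (tsum (fun x y => E) t) : ring_scope.

Section Bilinearity.
Variables (k : fieldType) (U V W : lmodType k).

Lemma tensPl a (x y : U) (v : V) : (a *: x + y) ⊗ v = a *: (x ⊗ v) + y ⊗ v.
Proof. exact: (@tens_bilin k U V).1. Qed.

Lemma tensPr a (u : U) (x y : V) : u ⊗ (a *: x + y) = a *: (u ⊗ x) + u ⊗ y.
Proof. exact: (@tens_bilin k U V).2. Qed.

Lemma tsumP (f : U -> V -> W) a t t' : bilin f ->
  tsum f (a *: t + t') = a *: tsum f t + tsum f t'.
Proof. by move=> bf; apply: tsum_linear. Qed.

Lemma tsumPf (f g h : U -> V -> W) a t :
  (forall u v, f u v = a *: g u v + h u v) ->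
  tsum f t = a *: tsum g t + tsum h t.
Proof.
move=> e; rewrite /tsum scaler_sumr -big_split /=.
by apply: eq_bigr => p _; apply: e.
Qed.

End Bilinearity.

Section LinearMaps.
Variable k : fieldType.

Section Tmap.
Variables (U V U' V' : lmodType k) (f : {linear U -> U'}) (g : {linear V -> V'}).

Definition tmap (t : U ⨂ V) : U' ⨂ V' := \tsum_(u ⊗ v <- t) f u ⊗ g v.

Lemma tmap_bilin : bilin (fun u v => f u ⊗ g v).
Proof. by split=> [v|u] a x y /=; rewrite linearP ?tensPl ?tensPr. Qed.

HB.instance Definition _ :=
  GRing.isLinear.Build k (U ⨂ V) (U' ⨂ V') *:%R tmap
    (tsum_linear tmap_bilin).

Lemma tmapE u v : tmap (u ⊗ v) = f u ⊗ g v.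
Proof. exact: tsum_tens tmap_bilin. Qed.
End Tmap.

Section Tassoc.
Variables U V W : lmodType k.

Definition tassoc (t : (U ⨂ V) ⨂ W) : U ⨂ (V ⨂ W) :=
  \tsum_(x ⊗ w <- t) \tsum_(u ⊗ v <- x) u ⊗ (v ⊗ w).

Lemma tassoc_bilin1 (w : W) : bilin (fun (u : U) (v : V) => u ⊗ (v ⊗ w)).
Proof. by split=> [v|u] a x y /=; rewrite ?tensPl ?tensPr. Qed.

Lemma tassoc_bilin :
  bilin (fun (x : U ⨂ V) (w : W) => \tsum_(u ⊗ v <- x) u ⊗ (v ⊗ w)).
Proof.
split=> [w|x] a y z /=; first exact/tsumP/tassoc_bilin1.
by apply: tsumPf => u v; rewrite !tensPr.
Qed.

HB.instance Definition _ :=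
  GRing.isLinear.Build k ((U ⨂ V) ⨂ W) (U ⨂ (V ⨂ W)) *:%R tassoc
    (tsum_linear tassoc_bilin).

Lemma tassocE u v w : tassoc ((u ⊗ v) ⊗ w) = u ⊗ (v ⊗ w).
Proof.
by rewrite /tassoc (tsum_tens _ _ tassoc_bilin) (tsum_tens _ _ (tassoc_bilin1 w)).
Qed.
End Tassoc.

Section LinearInverse.
Variables (U V : lmodType k) (f : {linear U -> V}) (bf : bijective f).

Lemma linv_ex v : exists u, f u == v.
Proof. by case: bf => g _ fK; exists (g v); rewrite fK. Qed.

Definition linv (v : V) : U := xchoose (linv_ex v).

Lemma linvK : cancel linv f.
Proof. by move=> v; apply/eqP; apply: xchooseP (linv_ex v). Qed.

Lemma lfunK : cancel f linv.
Proof. by move=> u; apply: (bij_inj bf); rewrite linvK. Qed.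

Lemma linv_linear : linear linv.
Proof. by move=> a x y; apply: (bij_inj bf); rewrite linearP !linvK. Qed.

HB.instance Definition _ :=
  GRing.isLinear.Build k V U *:%R linv linv_linear.
End LinearInverse.

End LinearMaps.

Section HomStructures.
Variable k : fieldType.

Record hom_associative (A : lmodType k) (mu : {linear A ⨂ A -> A})
    (alpha : {linear A -> A}) : Prop := {
  hom_alpha_mul : forall a a', alpha (mu (a ⊗ a')) = mu (alpha a ⊗ alpha a');
  hom_mulA : forall a a' a'',
    mu (alpha a ⊗ mu (a' ⊗ a'')) = mu (mu (a ⊗ a') ⊗ alpha a'')
}.

Record hom_bialgebra (H : lmodType k) (mu : {linear H ⨂ H -> H})
    (Delta : {linear H -> H ⨂ H}) (alpha : {linear H -> H}) : Prop := {
  hom_bialg_assoc : hom_associative mu alpha;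
  hom_coassoc : forall h,
    tassoc (tmap Delta alpha (Delta h)) = tmap alpha Delta (Delta h);
  hom_comul_mul : forall h h', Delta (mu (h ⊗ h')) =
    \tsum_(h1 ⊗ h2 <- Delta h) \tsum_(h'1 ⊗ h'2 <- Delta h')
      mu (h1 ⊗ h'1) ⊗ mu (h2 ⊗ h'2);
  hom_comul_alpha : forall h, Delta (alpha h) = tmap alpha alpha (Delta h)
}.

Section Modules.
Variables (A : lmodType k) (mu : {linear A ⨂ A -> A}) (alpha : {linear A -> A}).
Variables (M : lmodType k) (alphaM : {linear M -> M}).

Record hom_left_module (lact : {linear A ⨂ M -> M}) : Prop := {
  hom_lact_alpha : forall a m, alphaM (lact (a ⊗ m)) = lact (alpha a ⊗ alphaM m);
  hom_lactA : forall a a' m,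
    lact (alpha a ⊗ lact (a' ⊗ m)) = lact (mu (a ⊗ a') ⊗ alphaM m)
}.

Record hom_right_module (ract : {linear M ⨂ A -> M}) : Prop := {
  hom_ract_alpha : forall m a, alphaM (ract (m ⊗ a)) = ract (alphaM m ⊗ alpha a);
  hom_ractA : forall m a a',
    ract (ract (m ⊗ a) ⊗ alpha a') = ract (alphaM m ⊗ mu (a ⊗ a'))
}.

Record hom_bimodule (lact : {linear A ⨂ M -> M})
    (ract : {linear M ⨂ A -> M}) : Prop := {
  hom_bimod_left : hom_left_module lact;
  hom_bimod_right : hom_right_module ract;
  hom_bimodA : forall a m a',
    lact (alpha a ⊗ ract (m ⊗ a')) = ract (lact (a ⊗ m) ⊗ alpha a')
}.
End Modules.

Record bimodule_hom_algebra (H : lmodType k) (muH : {linear H ⨂ H -> H})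
    (DeltaH : {linear H -> H ⨂ H}) (alphaH : {linear H -> H})
    (D : lmodType k) (muD : {linear D ⨂ D -> D}) (alphaD : {linear D -> D})
    (lact : {linear H ⨂ D -> D}) (ract : {linear D ⨂ H -> D}) : Prop := {
  bha_assoc : hom_associative muD alphaD;
  bha_bimodule : hom_bimodule muH alphaH alphaD lact ract;
  bha_lact_mul : forall h d d', lact (alphaH (alphaH h) ⊗ muD (d ⊗ d')) =
    \tsum_(h1 ⊗ h2 <- DeltaH h) muD (lact (h1 ⊗ d) ⊗ lact (h2 ⊗ d'));
  bha_ract_mul : forall h d d', ract (muD (d ⊗ d') ⊗ alphaH (alphaH h)) =
    \tsum_(h1 ⊗ h2 <- DeltaH h) muD (ract (d ⊗ h1) ⊗ ract (d' ⊗ h2))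
}.

Section LRTwisted.
Variables (A : lmodType k) (muA : {linear A ⨂ A -> A}) (alphaA : {linear A -> A}).
Variables (B : lmodType k) (muB : {linear B ⨂ B -> B}) (alphaB : {linear B -> B}).
Variables (R : {linear B ⨂ A -> A ⨂ B}) (Q : {linear A ⨂ B -> A ⨂ B}).

Record LR_twisting : Prop := {
  LR_alphaR : forall a b,
    tmap alphaA alphaB (R (b ⊗ a)) = R (alphaB b ⊗ alphaA a);
  LR_alphaQ : forall a b,
    tmap alphaA alphaB (Q (a ⊗ b)) = Q (alphaA a ⊗ alphaB b);
  LR_mulA_R : forall a a' b, R (alphaB b ⊗ muA (a ⊗ a')) =
    \tsum_(aR ⊗ bR <- R (b ⊗ a)) \tsum_(a'r ⊗ bRr <- R (bR ⊗ a'))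
      muA (aR ⊗ a'r) ⊗ alphaB bRr;
  LR_mulB_R : forall a b b', R (muB (b ⊗ b') ⊗ alphaA a) =
    \tsum_(aR ⊗ b'R <- R (b' ⊗ a)) \tsum_(aRr ⊗ br <- R (b ⊗ aR))
      alphaA aRr ⊗ muB (br ⊗ b'R);
  LR_mulA_Q : forall a a' b, Q (muA (a ⊗ a') ⊗ alphaB b) =
    \tsum_(a'Q ⊗ bQ <- Q (a' ⊗ b)) \tsum_(aq ⊗ bQq <- Q (a ⊗ bQ))
      muA (aq ⊗ a'Q) ⊗ alphaB bQq;
  LR_mulB_Q : forall a b b', Q (alphaA a ⊗ muB (b ⊗ b')) =
    \tsum_(aQ ⊗ bQ <- Q (a ⊗ b)) \tsum_(aQq ⊗ b'q <- Q (aQ ⊗ b'))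
      alphaA aQq ⊗ muB (bQ ⊗ b'q);
  LR_RQ_BAB : forall a b b',
    \tsum_(aR ⊗ bR <- R (b ⊗ a)) \tsum_(aRQ ⊗ b'Q <- Q (aR ⊗ b'))
      bR ⊗ (aRQ ⊗ b'Q) =
    \tsum_(aQ ⊗ b'Q <- Q (a ⊗ b')) \tsum_(aQR ⊗ bR <- R (b ⊗ aQ))
      bR ⊗ (aQR ⊗ b'Q);
  LR_RQ_ABA : forall a a' b,
    \tsum_(aR ⊗ bR <- R (b ⊗ a)) \tsum_(a'Q ⊗ bRQ <- Q (a' ⊗ bR))
      aR ⊗ (bRQ ⊗ a'Q) =
    \tsum_(a'Q ⊗ bQ <- Q (a' ⊗ b)) \tsum_(aR ⊗ bQR <- R (bQ ⊗ a))
      aR ⊗ (bQR ⊗ a'Q)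
}.

Definition LR_mul2 (a : A) (b : B) (a' : A) (b' : B) : A ⨂ B :=
  \tsum_(aQ ⊗ b'Q <- Q (a ⊗ b')) \tsum_(a'R ⊗ bR <- R (b ⊗ a'))
    muA (aQ ⊗ a'R) ⊗ muB (bR ⊗ b'Q).

Definition LR_mul (t : (A ⨂ B) ⨂ (A ⨂ B)) : A ⨂ B :=
  \tsum_(x ⊗ x' <- t) \tsum_(a ⊗ b <- x) \tsum_(a' ⊗ b' <- x') LR_mul2 a b a' b'.

Lemma LR_mul2_bilin0 (aQ : A) (b'Q : B) :
  bilin (fun a'R bR => muA (aQ ⊗ a'R) ⊗ muB (bR ⊗ b'Q)).
Proof.
by split=> [v|u] a x y /=; rewrite !(tensPl, tensPr, linearP).
Qed.

Lemma LR_mul2_bilin1 (y : A ⨂ B) :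
  bilin (fun aQ b'Q =>
    \tsum_(a'R ⊗ bR <- y) muA (aQ ⊗ a'R) ⊗ muB (bR ⊗ b'Q)).
Proof.
by split=> [v|u] a x z /=; apply: tsumPf => ? ?; rewrite !(tensPl, tensPr, linearP).
Qed.

Lemma LR_mul2_bilinr (a : A) (b : B) : bilin (LR_mul2 a b).
Proof.
split=> [b'|a'] c x y; rewrite /LR_mul2 tensPr linearP.
- by apply: tsumPf => ? ?; apply/tsumP/LR_mul2_bilin0.
- exact/tsumP/LR_mul2_bilin1.
Qed.

Lemma LR_mul2_bilinl (a' : A) (b' : B) : bilin (fun a b => LR_mul2 a b a' b').
Proof.
split=> [b|a] c x y; rewrite /LR_mul2 tensPl linearP.
- exact/tsumP/LR_mul2_bilin1.
- by apply: tsumPf => ? ?; apply/tsumP/LR_mul2_bilin0.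
Qed.

Lemma LR_mul_bilin1 (x' : A ⨂ B) :
  bilin (fun a b => \tsum_(a' ⊗ b' <- x') LR_mul2 a b a' b').
Proof.
split=> [b|a] c x y /=; apply: tsumPf => a' b'.
- exact: (LR_mul2_bilinl a' b').1.
- exact: (LR_mul2_bilinl a' b').2.
Qed.

Lemma LR_mul_bilin : bilin (fun x x' =>
  \tsum_(a ⊗ b <- x) \tsum_(a' ⊗ b' <- x') LR_mul2 a b a' b').
Proof.
split=> [x'|x] c y z /=; first exact/tsumP/LR_mul_bilin1.
by apply: tsumPf => a b; apply/tsumP/LR_mul2_bilinr.
Qed.

HB.instance Definition _ :=
  GRing.isLinear.Build k ((A ⨂ B) ⨂ (A ⨂ B)) (A ⨂ B) *:%R LR_mul
    (tsum_linear LR_mul_bilin).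

Lemma LR_mulE a b a' b' : LR_mul ((a ⊗ b) ⊗ (a' ⊗ b')) =
  \tsum_(aQ ⊗ b'Q <- Q (a ⊗ b')) \tsum_(a'R ⊗ bR <- R (b ⊗ a'))
    muA (aQ ⊗ a'R) ⊗ muB (bR ⊗ b'Q).
Proof.
rewrite /LR_mul (tsum_tens _ _ LR_mul_bilin).
by rewrite (tsum_tens _ _ (LR_mul_bilin1 _)) (tsum_tens _ _ (LR_mul2_bilinr a b)).
Qed.

End LRTwisted.

Section Natural.
Variables (H : lmodType k) (DeltaH : {linear H -> H ⨂ H}) (alphaH : {linear H -> H}).
Variables (D : lmodType k) (alphaD : {linear D -> D}).
Variables (lact : {linear H ⨂ D -> D}) (ract : {linear D ⨂ H -> D}).
Variables (bijH : bijective alphaH) (bijD : bijective alphaD).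

Local Notation aHi := (linv bijH).
Local Notation aDi := (linv bijD).

Definition natR (t : H ⨂ D) : D ⨂ H :=
  \tsum_(h ⊗ d <- t) \tsum_(h1 ⊗ h2 <- DeltaH h)
    lact (aHi (aHi h1) ⊗ aDi d) ⊗ aHi h2.

Definition natQ (t : D ⨂ H) : D ⨂ H :=
  \tsum_(d ⊗ h <- t) \tsum_(h1 ⊗ h2 <- DeltaH h)
    ract (aDi d ⊗ aHi (aHi h2)) ⊗ aHi h1.

Lemma natR_bilin1 d :
  bilin (fun h1 h2 => lact (aHi (aHi h1) ⊗ aDi d) ⊗ aHi h2).
Proof. by split=> [v|u] a x y /=; rewrite !(linearP, tensPl, tensPr). Qed.

Lemma natR_bilin : bilin (fun h d => \tsum_(h1 ⊗ h2 <- DeltaH h)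
  lact (aHi (aHi h1) ⊗ aDi d) ⊗ aHi h2).
Proof.
split=> [d|h] a x y /=; first by rewrite linearP; apply/tsumP/natR_bilin1.
by apply: tsumPf => ? ?; rewrite !(linearP, tensPl, tensPr).
Qed.

Lemma natQ_bilin1 d :
  bilin (fun h1 h2 => ract (aDi d ⊗ aHi (aHi h2)) ⊗ aHi h1).
Proof. by split=> [v|u] a x y /=; rewrite !(linearP, tensPl, tensPr). Qed.

Lemma natQ_bilin : bilin (fun d h => \tsum_(h1 ⊗ h2 <- DeltaH h)
  ract (aDi d ⊗ aHi (aHi h2)) ⊗ aHi h1).
Proof.
split=> [h|d] a x y /=; last by rewrite linearP; apply/tsumP/natQ_bilin1.
by apply: tsumPf => ? ?; rewrite !(linearP, tensPl, tensPr).
Qed.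

HB.instance Definition _ :=
  GRing.isLinear.Build k (H ⨂ D) (D ⨂ H) *:%R natR
    (tsum_linear natR_bilin).
HB.instance Definition _ :=
  GRing.isLinear.Build k (D ⨂ H) (D ⨂ H) *:%R natQ
    (tsum_linear natQ_bilin).

Lemma natRE h d : natR (h ⊗ d) = \tsum_(h1 ⊗ h2 <- DeltaH h)
  lact (aHi (aHi h1) ⊗ aDi d) ⊗ aHi h2.
Proof. exact: tsum_tens natR_bilin. Qed.

Lemma natQE d h : natQ (d ⊗ h) = \tsum_(h1 ⊗ h2 <- DeltaH h)
  ract (aDi d ⊗ aHi (aHi h2)) ⊗ aHi h1.
Proof. exact: tsum_tens natQ_bilin. Qed.

End Natural.

End HomStructures.

(* Main.v *)
(* Identities in tensor products are used by applying an arbitrary (tri)linear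
   map to both sides; coassociativity is rewritten under Sweedler sums this way.
   In a twisted product, (3)-(6) and Hom-associativity of A and B turn both
   sides of the Hom-associativity law into sums of the same terms
     (a_Q'Q'' a'_Qr) α(a''_Rr') ⊗ (b_rr' b'_RQ') α(b''_QQ''),
   except that the two twistings of a', resp. b', occur in opposite orders;
   (7) and (8) exchange them. For the maps of the theorem, (3) and (5) come from
   the compatibility of the actions with μ_D and coassociativity, (4) and (6)
   from the module axioms and the multiplicativity of Δ, (7) from the bimodule
   axiom, and (8) from coassociativity. *)

Require Import Defs.
From HB Require Import structures.
From mathcomp Require Import all_boot all_algebra.
Set Implicit Arguments.
Unset Strict Implicit.
Unset Printing Implicit Defensive.

Import GRing.Theory.
Local Open Scope ring_scope.

(** * Calculus of Sweedler sums: exchange, nesting and reduction to pure tensors *)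

Section TsumTheory.
Variable k : fieldType.
Implicit Types U V W X : lmodType k.

Lemma eq_tsum U V W (f g : U -> V -> W) t :
  (forall u v, f u v = g u v) -> tsum f t = tsum g t.
Proof. by move=> e; apply: eq_bigr => p _; apply: e. Qed.

Lemma linear_tsum U V W X (g : {linear W -> X}) (f : U -> V -> W) t :
  g (tsum f t) = \tsum_(u ⊗ v <- t) g (f u v).
Proof. exact: linear_sum. Qed.

Lemma linear_for_tsum U V W X (g : W -> X) (f : U -> V -> W) t :
  linear g -> g (tsum f t) = \tsum_(u ⊗ v <- t) g (f u v).
Proof.
move=> lg.
pose G : {linear W -> X} := HB.pack g (GRing.isLinear.Build k W X *:%R g lg).
exact: (linear_tsum G).
Qed.

Lemma exchange_tsum U V U' V' W (f : U -> V -> U' -> V' -> W) t t' :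
  \tsum_(u ⊗ v <- t) \tsum_(x ⊗ y <- t') f u v x y =
  \tsum_(x ⊗ y <- t') \tsum_(u ⊗ v <- t) f u v x y.
Proof. exact: exchange_big. Qed.

(** The expression chosen for the tensor [tsum g t] need not be the one displayed, so nested sums
    are flattened through the linearity of [tsum f], which comes from the bilinearity of [f]. *)
Lemma tsum_tsum U V U' V' W (f : U -> V -> W) (g : U' -> V' -> U ⨂ V) t :
  bilin f -> tsum f (tsum g t) = \tsum_(x ⊗ y <- t) tsum f (g x y).
Proof.
by move=> bf; apply/linear_for_tsum/tsum_linear.
Qed.

(** Counterpart of [tensor_linear_ext] for composite expressions that carry no declared linear
    structure; their linearity is left as side conditions for [multilin]. *)
Lemma tensor_ext U V W (f g : U ⨂ V -> W) : linear f -> linear g ->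
  (forall u v, f (u ⊗ v) = g (u ⊗ v)) -> forall t, f t = g t.
Proof.
move=> lf lg.
pose F : {linear U ⨂ V -> W} := HB.pack f (GRing.isLinear.Build k _ W *:%R f lf).
pose G : {linear U ⨂ V -> W} := HB.pack g (GRing.isLinear.Build k _ W *:%R g lg).
exact: (@tensor_linear_ext k U V W F G).
Qed.

End TsumTheory.

(* Proves that an expression built from [⊗], linear maps and [\tsum] is linear
   in one variable, or bilinear in two, each occurring exactly once. *)
Ltac multilin := lazymatch goal with
  | |- bilinear_for _ _ _ => split=> ? ? ? ? /=; multilin
  | |- forall _, _ => move=> ?; multilin
  | |- GRing.linear_for _ _ => move=> ? ? ? /=; multilin
  | |- _ => first
    [ reflexivity
    | progress rewrite ?(linearP, tensPl, tensPr) /=; multilin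
    | apply: tsumP; multilin
    | apply: tsumPf => ? ? /=; multilin ]
  end.

(** * Sweedler sums over threefold tensors *)

Section TsumTensor.
Variable k : fieldType.
Implicit Types U V W X : lmodType k.

Lemma tens_tsuml U V W X (f : U -> V -> W) t (x : X) :
  tsum f t ⊗ x = \tsum_(u ⊗ v <- t) f u v ⊗ x.
Proof. by apply: (linear_for_tsum (g := fun w => w ⊗ x)); multilin. Qed.

Lemma tens_tsumr U V W X (f : U -> V -> W) t (x : X) :
  x ⊗ tsum f t = \tsum_(u ⊗ v <- t) x ⊗ f u v.
Proof. by apply: (linear_for_tsum (g := tens x)); multilin. Qed.

Lemma tsum_tmap U V U' V' W (a : {linear U -> U'}) (b : {linear V -> V'})
    (f : U' -> V' -> W) t :
  bilin f -> tsum f (tmap a b t) = \tsum_(u ⊗ v <- t) f (a u) (b v).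
Proof.
by move=> bf; rewrite tsum_tsum //; apply: eq_tsum => u v; rewrite tsum_tens.
Qed.

Variables (U V W X : lmodType k) (F : U -> V -> W -> X).
Hypothesis bF12 : forall w, bilin (fun u v => F u v w).
Hypothesis bF23 : forall u, bilin (F u).

(** The two hypotheses on [F] together say that it is trilinear. This lemma and the next make [F]
    descend to [U ⨂ (V ⨂ W)] and to [(U ⨂ V) ⨂ W]. *)
Lemma tsum_bilin_l : bilin (fun u t => \tsum_(v ⊗ w <- t) F u v w).
Proof.
split=> [t|u] a x y /=; last exact: tsumP.
by apply: tsumPf => v w; apply: (bF12 w).1.
Qed.

Lemma tsum_bilin_r : bilin (fun t w => \tsum_(u ⊗ v <- t) F u v w).
Proof.
split=> [w|t] a x y /=; first exact: tsumP.
by apply: tsumPf => u v; apply: (bF23 u).2.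
Qed.

Lemma tsum_tens3 u v w :
  \tsum_(x ⊗ t <- u ⊗ (v ⊗ w)) \tsum_(y ⊗ z <- t) F x y z = F u v w.
Proof. by rewrite (tsum_tens _ _ tsum_bilin_l) tsum_tens. Qed.

Lemma tsum_tsum_tens3 U1 V1 U2 V2 (t : U1 ⨂ V1) (s : U1 -> V1 -> U2 ⨂ V2)
    (a : U1 -> V1 -> U2 -> V2 -> U) (b : U1 -> V1 -> U2 -> V2 -> V)
    (c : U1 -> V1 -> U2 -> V2 -> W) :
  \tsum_(x ⊗ r <- \tsum_(p ⊗ q <- t) \tsum_(p' ⊗ q' <- s p q)
                    a p q p' q' ⊗ (b p q p' q' ⊗ c p q p' q'))
    \tsum_(y ⊗ z <- r) F x y z =
  \tsum_(p ⊗ q <- t) \tsum_(p' ⊗ q' <- s p q)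
    F (a p q p' q') (b p q p' q') (c p q p' q').
Proof.
rewrite tsum_tsum; last exact: tsum_bilin_l.
apply: eq_tsum => p q; rewrite tsum_tsum; last exact: tsum_bilin_l.
by apply: eq_tsum => p' q'; rewrite tsum_tens3.
Qed.

Lemma tsum_tassoc t :
  \tsum_(u ⊗ s <- tassoc t) \tsum_(v ⊗ w <- s) F u v w =
  \tsum_(s ⊗ w <- t) \tsum_(u ⊗ v <- s) F u v w.
Proof.
rewrite tsum_tsum; last exact: tsum_bilin_l.
apply: eq_tsum => s w; rewrite tsum_tsum; last exact: tsum_bilin_l.
by apply: eq_tsum => u v; rewrite tsum_tens3.
Qed.

End TsumTensor.

(** * The twisting axioms as rewriting rules under a Sweedler sum *)

Section Twisted.
Variable k : fieldType.
Variables (A : lmodType k) (muA : {linear A ⨂ A -> A}) (alphaA : {linear A -> A}).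
Variables (B : lmodType k) (muB : {linear B ⨂ B -> B}) (alphaB : {linear B -> B}).
Variables (R : {linear B ⨂ A -> A ⨂ B}) (Q : {linear A ⨂ B -> A ⨂ B}).
Hypothesis twRQ : LR_twisting muA alphaA muB alphaB R Q.
Variable W : lmodType k.
Implicit Types (f : A -> B -> W).

Lemma tsum_alphaR f a b : bilin f ->
  tsum f (R (alphaB b ⊗ alphaA a)) =
  \tsum_(x ⊗ y <- R (b ⊗ a)) f (alphaA x) (alphaB y).
Proof. by move=> bf; rewrite -(LR_alphaR twRQ) tsum_tmap. Qed.

Lemma tsum_alphaQ f a b : bilin f ->
  tsum f (Q (alphaA a ⊗ alphaB b)) =
  \tsum_(x ⊗ y <- Q (a ⊗ b)) f (alphaA x) (alphaB y).
Proof. by move=> bf; rewrite -(LR_alphaQ twRQ) tsum_tmap. Qed.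

Let tsum_tens2 f (F : A -> B -> A -> B -> A) (G : A -> B -> A -> B -> B) t
  (s : A -> B -> A ⨂ B) : bilin f ->
  tsum f (\tsum_(a ⊗ b <- t) \tsum_(a' ⊗ b' <- s a b) F a b a' b' ⊗ G a b a' b') =
  \tsum_(a ⊗ b <- t) \tsum_(a' ⊗ b' <- s a b) f (F a b a' b') (G a b a' b').
Proof.
move=> bf; rewrite tsum_tsum //; apply: eq_tsum => a b.
by rewrite tsum_tsum //; apply: eq_tsum => a' b'; rewrite tsum_tens.
Qed.

Lemma tsum_mulA_R f a a' b : bilin f ->
  tsum f (R (alphaB b ⊗ muA (a ⊗ a'))) =
  \tsum_(x ⊗ y <- R (b ⊗ a)) \tsum_(x' ⊗ z <- R (y ⊗ a'))
    f (muA (x ⊗ x')) (alphaB z).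
Proof. by move=> bf; rewrite (LR_mulA_R twRQ) tsum_tens2. Qed.

Lemma tsum_mulB_R f a b b' : bilin f ->
  tsum f (R (muB (b ⊗ b') ⊗ alphaA a)) =
  \tsum_(x ⊗ y' <- R (b' ⊗ a)) \tsum_(z ⊗ y <- R (b ⊗ x))
    f (alphaA z) (muB (y ⊗ y')).
Proof. by move=> bf; rewrite (LR_mulB_R twRQ) tsum_tens2. Qed.

Lemma tsum_mulA_Q f a a' b : bilin f ->
  tsum f (Q (muA (a ⊗ a') ⊗ alphaB b)) =
  \tsum_(x' ⊗ y <- Q (a' ⊗ b)) \tsum_(x ⊗ z <- Q (a ⊗ y))
    f (muA (x ⊗ x')) (alphaB z).
Proof. by move=> bf; rewrite (LR_mulA_Q twRQ) tsum_tens2. Qed.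

Lemma tsum_mulB_Q f a b b' : bilin f ->
  tsum f (Q (alphaA a ⊗ muB (b ⊗ b'))) =
  \tsum_(x ⊗ y <- Q (a ⊗ b)) \tsum_(z ⊗ y' <- Q (x ⊗ b'))
    f (alphaA z) (muB (y ⊗ y')).
Proof. by move=> bf; rewrite (LR_mulB_Q twRQ) tsum_tens2. Qed.

Lemma tsum_RQ_BAB (F : B -> A -> B -> W) a b b' :
  (forall z, bilin (fun x y => F x y z)) -> (forall x, bilin (F x)) ->
  \tsum_(x ⊗ y <- R (b ⊗ a)) \tsum_(z ⊗ y' <- Q (x ⊗ b')) F y z y' =
  \tsum_(x ⊗ y' <- Q (a ⊗ b')) \tsum_(z ⊗ y <- R (b ⊗ x)) F y z y'.
Proof.
move=> F12 F23.
(* The map applied to both sides is the one that [F] induces on [B ⨂ (A ⨂ B)]. *)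
have /(congr1 (tsum (fun u t => tsum (F u) t))) := LR_RQ_BAB twRQ a b b'.
by rewrite !tsum_tsum_tens3.
Qed.

Lemma tsum_RQ_ABA (F : A -> B -> A -> W) a a' b :
  (forall z, bilin (fun x y => F x y z)) -> (forall x, bilin (F x)) ->
  \tsum_(x ⊗ y <- R (b ⊗ a)) \tsum_(x' ⊗ z <- Q (a' ⊗ y)) F x z x' =
  \tsum_(x' ⊗ y <- Q (a' ⊗ b)) \tsum_(x ⊗ z <- R (y ⊗ a)) F x z x'.
Proof.
move=> F12 F23.
have /(congr1 (tsum (fun u t => tsum (F u) t))) := LR_RQ_ABA twRQ a a' b.
by rewrite !tsum_tsum_tens3.
Qed.

End Twisted.

(** * Hom-associativity of the twisted product *)

Section TwistedProduct.
Variable k : fieldType.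
Variables (A : lmodType k) (muA : {linear A ⨂ A -> A}) (alphaA : {linear A -> A}).
Variables (B : lmodType k) (muB : {linear B ⨂ B -> B}) (alphaB : {linear B -> B}).
Variables (R : {linear B ⨂ A -> A ⨂ B}) (Q : {linear A ⨂ B -> A ⨂ B}).
Hypotheses (assocA : hom_associative muA alphaA) (assocB : hom_associative muB alphaB).
Hypothesis twRQ : LR_twisting muA alphaA muB alphaB R Q.
Local Notation mul := (LR_mul muA muB R Q).
Local Notation alpha := (tmap alphaA alphaB).

Lemma LR_mul_alpha t t' : alpha (mul (t ⊗ t')) = mul (alpha t ⊗ alpha t').
Proof.
move: t; refine (tensor_ext _ _ _); [by multilin|by multilin|].
move=> a b; move: t'; refine (tensor_ext _ _ _); [by multilin|by multilin|].
move=> a' b' /=; rewrite !tmapE !LR_mulE linear_tsum (tsum_alphaQ twRQ); last by multilin.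
apply: eq_tsum => x y; rewrite linear_tsum (tsum_alphaR twRQ); last by multilin.
by apply: eq_tsum => x' y'; rewrite /= tmapE !(hom_alpha_mul assocA, hom_alpha_mul assocB).
Qed.

Lemma LR_mulA t t' t'' :
  mul (alpha t ⊗ mul (t' ⊗ t'')) = mul (mul (t ⊗ t') ⊗ alpha t'').
Proof.
move: t; refine (tensor_ext _ _ _); [by multilin|by multilin|].
move=> a b; move: t'; refine (tensor_ext _ _ _); [by multilin|by multilin|].
move=> a' b'; move: t''; refine (tensor_ext _ _ _); [by multilin|by multilin|].
move=> a'' b'' /=; rewrite !tmapE !LR_mulE.
(* [G] performs the two outermost twistings, [Q] between [a] and [b''] and [R] between [b] and
   [a''], which both bracketings share. Its arguments stand for [a], [b'], [a''], [a'], [b], [b'']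
   after the inner twistings. *)
pose G (x : A) (y' : B) (x'' : A) (x' : A) (y : B) (y'' : B) :=
  \tsum_(z ⊗ w <- Q (x ⊗ y'')) \tsum_(z'' ⊗ w'' <- R (y ⊗ x''))
    muA (muA (z ⊗ x') ⊗ alphaA z'') ⊗ muB (muB (w'' ⊗ y') ⊗ alphaB w).
(* This is the order of twistings in the right-bracketed product: [b'] meets [a''] before [a], and
   [a'] meets [b''] before [b]. *)
transitivity (\tsum_(x'' ⊗ y' <- R (b' ⊗ a'')) \tsum_(x ⊗ z <- Q (a ⊗ y'))
   \tsum_(x' ⊗ y'' <- Q (a' ⊗ b'')) \tsum_(w ⊗ y <- R (b ⊗ x'))
      G x z x'' w y y'').
  transitivity (\tsum_(x' ⊗ y'' <- Q (a' ⊗ b'')) \tsum_(x'' ⊗ y' <- R (b' ⊗ a''))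
    \tsum_(x ⊗ z <- Q (a ⊗ y')) \tsum_(w ⊗ y <- R (b ⊗ x')) G x z x'' w y y'').
    rewrite tens_tsumr linear_tsum /=; apply: eq_tsum => x' y''.
    rewrite tens_tsumr linear_tsum /=; apply: eq_tsum => x'' y'.
    (* The outer product twists [a] past a product in [B] and [b] past a product in [A]; both
       twistings split into two, and Hom-associativity of [A] and [B] then brackets to the left as
       in [G]. *)
    rewrite LR_mulE (tsum_mulB_Q twRQ); last by multilin.
    apply: eq_tsum => x z; rewrite /G [RHS]exchange_tsum; apply: eq_tsum => u v.
    rewrite (tsum_mulA_R twRQ); last by multilin.
    apply: eq_tsum => p q; apply: eq_tsum => r s.
    by rewrite (hom_mulA assocA) (hom_mulA assocB).
  rewrite exchange_tsum; apply: eq_tsum => x'' y'; exact: exchange_tsum.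
(* Exchanges the two twistings of [b']: now [a] comes before [a'']. *)
rewrite (tsum_RQ_ABA twRQ (F := fun x'' z x =>
   \tsum_(x' ⊗ y'' <- Q (a' ⊗ b'')) \tsum_(w ⊗ y <- R (b ⊗ x'))
      G x z x'' w y y'')); first last.
- by rewrite /G; multilin.
- by rewrite /G; multilin.
rewrite tens_tsuml linear_tsum /=; apply: eq_tsum => x y'.
(* Exchanges the two twistings of [a']: now [b] comes before [b''], as in the left-bracketed
   product. *)
transitivity (\tsum_(x'' ⊗ z <- R (y' ⊗ a'')) \tsum_(x' ⊗ y <- R (b ⊗ a'))
  \tsum_(w ⊗ y'' <- Q (x' ⊗ b'')) G x z x'' w y y'').
  apply: eq_tsum => x'' z; symmetry.
  by apply: (tsum_RQ_BAB twRQ (F := fun y w y'' => G x z x'' w y y''));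
    rewrite /G; multilin.
rewrite exchange_tsum tens_tsuml linear_tsum /=; apply: eq_tsum => x' y.
(* Here the products are on the other side of the twistings. Once [Q] and [R] are split, the terms
   are those of [G], already bracketed to the left. *)
rewrite LR_mulE (tsum_mulA_Q twRQ); last by multilin.
rewrite [LHS]exchange_tsum; apply: eq_tsum => w y''.
rewrite /G [LHS]exchange_tsum.
apply: eq_tsum => u v; rewrite (tsum_mulB_R twRQ); last by multilin.
by [].
Qed.

Lemma hom_associative_LR_mul : hom_associative mul alpha.
Proof. by split; [exact: LR_mul_alpha|exact: LR_mulA]. Qed.

End TwistedProduct.

(** * Inverses of structure maps *)

Section Inverse.
Variable k : fieldType.

(** Three independent spaces allow the same statement to serve for both multiplications and both
    actions. *)
Lemma linv_mul (U V W : lmodType k) (m : {linear U ⨂ V -> W})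
    (aU : {linear U -> U}) (aV : {linear V -> V}) (aW : {linear W -> W})
    (bU : bijective aU) (bV : bijective aV) (bW : bijective aW) :
  (forall u v, aW (m (u ⊗ v)) = m (aU u ⊗ aV v)) ->
  forall u v, linv bW (m (u ⊗ v)) = m (linv bU u ⊗ linv bV v).
Proof. by move=> am u v; apply: (bij_inj bW); rewrite am !linvK. Qed.

End Inverse.

(** * The comultiplication axioms under a Sweedler sum *)

Section Comultiplication.
Variable k : fieldType.
Variables (H : lmodType k) (mu : {linear H ⨂ H -> H}).
Variables (Delta : {linear H -> H ⨂ H}) (alpha : {linear H -> H}).
Hypothesis bialgH : hom_bialgebra mu Delta alpha.
Variables (bijH : bijective alpha) (W : lmodType k).
Implicit Types f : H -> H -> W.

Lemma tsum_comul_alpha f h : bilin f ->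
  tsum f (Delta (alpha h)) = \tsum_(x ⊗ y <- Delta h) f (alpha x) (alpha y).
Proof. by move=> bf; rewrite (hom_comul_alpha bialgH) tsum_tmap. Qed.

Lemma tsum_comul_linv f h : bilin f ->
  tsum f (Delta (linv bijH h)) =
  \tsum_(x ⊗ y <- Delta h) f (linv bijH x) (linv bijH y).
Proof.
move=> bf; rewrite -{2}(linvK bijH h) tsum_comul_alpha.
  by apply: eq_tsum => x y; rewrite !lfunK.
by split=> [y|x] a u v /=; rewrite linearP; [apply: bf.1|apply: bf.2].
Qed.

Lemma tsum_comul_mul f h h' : bilin f ->
  tsum f (Delta (mu (h ⊗ h'))) =
  \tsum_(x ⊗ y <- Delta h) \tsum_(x' ⊗ y' <- Delta h')
    f (mu (x ⊗ x')) (mu (y ⊗ y')).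
Proof.
move=> bf; rewrite (hom_comul_mul bialgH) tsum_tsum //.
apply: eq_tsum => x y; rewrite tsum_tsum //.
by apply: eq_tsum => x' y'; rewrite tsum_tens.
Qed.

Lemma tsum_coassoc (F : H -> H -> H -> W) h :
  (forall z, bilin (fun x y => F x y z)) -> (forall x, bilin (F x)) ->
  \tsum_(x ⊗ z <- Delta h) \tsum_(x' ⊗ y <- Delta x) F x' y (alpha z) =
  \tsum_(x ⊗ y <- Delta h) \tsum_(y' ⊗ z <- Delta y) F (alpha x) y' z.
Proof.
move=> F12 F23; have bl := tsum_bilin_l F12 F23; have br := tsum_bilin_r F12 F23.
have /(congr1 (tsum (fun u t => tsum (F u) t))) := hom_coassoc bialgH h.
by rewrite tsum_tassoc // !tsum_tmap.
Qed.

End Comultiplication.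

(** * The twisting axioms for the maps [R] and [Q] of the theorem *)

Section NaturalTwisting.
Variable k : fieldType.
Variables (H : lmodType k) (muH : {linear H ⨂ H -> H}).
Variables (DeltaH : {linear H -> H ⨂ H}) (alphaH : {linear H -> H}).
Variables (D : lmodType k) (muD : {linear D ⨂ D -> D}) (alphaD : {linear D -> D}).
Variables (lact : {linear H ⨂ D -> D}) (ract : {linear D ⨂ H -> D}).
Hypothesis bialgH : hom_bialgebra muH DeltaH alphaH.
Hypothesis algD : bimodule_hom_algebra muH DeltaH alphaH muD alphaD lact ract.
Variables (bijD : bijective alphaD) (bijH : bijective alphaH).

Local Notation aHi := (linv bijH).
Local Notation aDi := (linv bijD).
Local Notation R := (natR DeltaH lact bijH bijD).
Local Notation Q := (natQ DeltaH ract bijH bijD).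

Let aHiM x y : aHi (muH (x ⊗ y)) = muH (aHi x ⊗ aHi y).
Proof. exact/linv_mul/(hom_alpha_mul (hom_bialg_assoc bialgH)). Qed.

Let aDiM x y : aDi (muD (x ⊗ y)) = muD (aDi x ⊗ aDi y).
Proof. exact/linv_mul/(hom_alpha_mul (bha_assoc algD)). Qed.

Let lact_alpha := hom_lact_alpha (hom_bimod_left (bha_bimodule algD)).
Let ract_alpha := hom_ract_alpha (hom_bimod_right (bha_bimodule algD)).

Let aDi_lact h d : aDi (lact (h ⊗ d)) = lact (aHi h ⊗ aDi d).
Proof. exact/linv_mul/lact_alpha. Qed.

Let aDi_ract d h : aDi (ract (d ⊗ h)) = ract (aDi d ⊗ aHi h).
Proof. exact/linv_mul/ract_alpha. Qed.

Lemma tsum_natR (W : lmodType k) (f : D -> H -> W) h d : bilin f ->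
  tsum f (R (h ⊗ d)) =
  \tsum_(x ⊗ y <- DeltaH h) f (lact (aHi (aHi x) ⊗ aDi d)) (aHi y).
Proof.
by move=> bf; rewrite natRE tsum_tsum //; apply: eq_tsum => x y; rewrite tsum_tens.
Qed.

Lemma tsum_natQ (W : lmodType k) (f : D -> H -> W) d h : bilin f ->
  tsum f (Q (d ⊗ h)) =
  \tsum_(x ⊗ y <- DeltaH h) f (ract (aDi d ⊗ aHi (aHi y))) (aHi x).
Proof.
by move=> bf; rewrite natQE tsum_tsum //; apply: eq_tsum => x y; rewrite tsum_tens.
Qed.

(** The module-algebra axiom, stated for the square of [alphaH], is applied to [aHi (aHi h)]; the
    two inverses then pass through [DeltaH] onto both legs. *)
Lemma lact_muD h d d' : lact (h ⊗ muD (d ⊗ d')) =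
  \tsum_(x ⊗ y <- DeltaH h)
    muD (lact (aHi (aHi x) ⊗ d) ⊗ lact (aHi (aHi y) ⊗ d')).
Proof.
rewrite -{1}(linvK bijH h) -{1}(linvK bijH (aHi h)) (bha_lact_mul algD).
by rewrite !(tsum_comul_linv bialgH) //; multilin.
Qed.

Lemma ract_muD h d d' : ract (muD (d ⊗ d') ⊗ h) =
  \tsum_(x ⊗ y <- DeltaH h)
    muD (ract (d ⊗ aHi (aHi x)) ⊗ ract (d' ⊗ aHi (aHi y))).
Proof.
rewrite -{1}(linvK bijH h) -{1}(linvK bijH (aHi h)) (bha_ract_mul algD).
by rewrite !(tsum_comul_linv bialgH) //; multilin.
Qed.

Lemma natR_mulD d d' h : R (alphaH h ⊗ muD (d ⊗ d')) =
  \tsum_(x ⊗ y <- R (h ⊗ d)) \tsum_(x' ⊗ z <- R (y ⊗ d'))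
    muD (x ⊗ x') ⊗ alphaH z.
Proof.
(* Both sides are values of [F] on the two forms of the iterated coproduct of [h]. On the left, one
   of the two inverses in [R] cancels against [alphaH h] and [lact_muD] adds two more, hence three;
   the inverse on [w] absorbs the [alphaH] of coassociativity. *)
pose F u v w := muD (lact (aHi (aHi (aHi u)) ⊗ aDi d)
                     ⊗ lact (aHi (aHi (aHi v)) ⊗ aDi d')) ⊗ aHi w.
transitivity (\tsum_(x ⊗ z <- DeltaH h) \tsum_(x' ⊗ y <- DeltaH x)
                F x' y (alphaH z)).
  rewrite natRE (tsum_comul_alpha bialgH); last by multilin.
  apply: eq_tsum => x z; rewrite !lfunK aDiM lact_muD tens_tsuml.
  rewrite (tsum_comul_linv bialgH); last by multilin.
  by apply: eq_tsum => x' y; rewrite /F lfunK.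
rewrite (tsum_coassoc bialgH); [|by rewrite /F; multilin..].
rewrite tsum_natR; last by multilin.
apply: eq_tsum => x y; rewrite tsum_natR; last by multilin.
rewrite (tsum_comul_linv bialgH); last by multilin.
by apply: eq_tsum => x' z; rewrite /F !(lfunK, linvK).
Qed.

Lemma natQ_mulD d d' h : Q (muD (d ⊗ d') ⊗ alphaH h) =
  \tsum_(x' ⊗ y <- Q (d' ⊗ h)) \tsum_(x ⊗ z <- Q (d ⊗ y))
    muD (x ⊗ x') ⊗ alphaH z.
Proof.
(* [Q] acts by the second leg and keeps the first, so the leg left in [H] is now [u], and
   coassociativity is used in the opposite direction. *)
pose F u v w := muD (ract (aDi d ⊗ aHi (aHi (aHi v)))
                     ⊗ ract (aDi d' ⊗ aHi (aHi (aHi w)))) ⊗ aHi u.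
transitivity (\tsum_(x ⊗ y <- DeltaH h) \tsum_(y' ⊗ z <- DeltaH y)
                F (alphaH x) y' z).
  rewrite natQE (tsum_comul_alpha bialgH); last by multilin.
  apply: eq_tsum => x y; rewrite !lfunK aDiM ract_muD tens_tsuml.
  rewrite (tsum_comul_linv bialgH); last by multilin.
  by apply: eq_tsum => y' z; rewrite /F lfunK.
rewrite -(tsum_coassoc bialgH); [|by rewrite /F; multilin..].
rewrite tsum_natQ; last by multilin.
apply: eq_tsum => x z; rewrite tsum_natQ; last by multilin.
rewrite (tsum_comul_linv bialgH); last by multilin.
by apply: eq_tsum => x' y; rewrite /F !(lfunK, linvK).
Qed.

Lemma natR_mulH d h h' : R (muH (h ⊗ h') ⊗ alphaD d) =
  \tsum_(x ⊗ y' <- R (h' ⊗ d)) \tsum_(z ⊗ y <- R (h ⊗ x))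
    alphaD z ⊗ muH (y ⊗ y').
Proof.
rewrite natRE (tsum_comul_mul bialgH); last by multilin.
rewrite exchange_tsum tsum_natR; last by multilin.
apply: eq_tsum => x' y'; rewrite tsum_natR; last by multilin.
apply: eq_tsum => x y; rewrite lfunK !aHiM aDi_lact !lact_alpha !linvK.
(* The module axiom expects an argument of the form [alphaD _], so [d] is written as
   [alphaD (aDi d)]. *)
rewrite -[X in lact (muH _ ⊗ X)](linvK bijD).
by rewrite -(hom_lactA (hom_bimod_left (bha_bimodule algD))) !linvK.
Qed.

Lemma natQ_mulH d h h' : Q (alphaD d ⊗ muH (h ⊗ h')) =
  \tsum_(x ⊗ y <- Q (d ⊗ h)) \tsum_(z ⊗ y' <- Q (x ⊗ h'))
    alphaD z ⊗ muH (y ⊗ y').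
Proof.
rewrite natQE (tsum_comul_mul bialgH); last by multilin.
rewrite tsum_natQ; last by multilin.
apply: eq_tsum => x y; rewrite tsum_natQ; last by multilin.
apply: eq_tsum => x' y'; rewrite lfunK !aHiM aDi_ract !ract_alpha !linvK.
rewrite -[X in ract (X ⊗ muH _)](linvK bijD).
by rewrite -(hom_ractA (hom_bimod_right (bha_bimodule algD))) !linvK.
Qed.

(** The coproducts of [h] and [h'] are independent, so their sums exchange; termwise the claim is
    that the left action of [h] and the right action of [h'] on [d] commute. *)
Lemma natR_natQ_HDH d h h' :
  \tsum_(x ⊗ y <- R (h ⊗ d)) \tsum_(z ⊗ y' <- Q (x ⊗ h')) y ⊗ (z ⊗ y') =
  \tsum_(x ⊗ y' <- Q (d ⊗ h')) \tsum_(z ⊗ y <- R (h ⊗ x)) y ⊗ (z ⊗ y').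
Proof.
rewrite tsum_natR; last by multilin.
rewrite tsum_natQ; last by multilin.
transitivity (\tsum_(x ⊗ y <- DeltaH h) \tsum_(x' ⊗ y' <- DeltaH h')
   aHi y ⊗ (ract (aDi (lact (aHi (aHi x) ⊗ aDi d)) ⊗ aHi (aHi y')) ⊗ aHi x')).
  by apply: eq_tsum => x y; rewrite tsum_natQ; last by multilin.
rewrite exchange_tsum; apply: eq_tsum => x' y'; rewrite tsum_natR; last by multilin.
apply: eq_tsum => x y; rewrite aDi_lact aDi_ract.
rewrite -[X in ract (_ ⊗ X)](linvK bijH) -(hom_bimodA (bha_bimodule algD)).
by rewrite !linvK.
Qed.

(** [R] consumes the first leg of the iterated coproduct of [h] and [Q] the last one; either order
    leaves the middle leg in [H], and the two results agree by coassociativity. *)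
Lemma natR_natQ_DHD d d' h :
  \tsum_(x ⊗ y <- R (h ⊗ d)) \tsum_(x' ⊗ z <- Q (d' ⊗ y)) x ⊗ (z ⊗ x') =
  \tsum_(x' ⊗ y <- Q (d' ⊗ h)) \tsum_(x ⊗ z <- R (y ⊗ d)) x ⊗ (z ⊗ x').
Proof.
pose F u v w := lact (aHi (aHi (aHi u)) ⊗ aDi d)
  ⊗ (aHi (aHi v) ⊗ ract (aDi d' ⊗ aHi (aHi (aHi w)))).
transitivity (\tsum_(x ⊗ y <- DeltaH h) \tsum_(y' ⊗ z <- DeltaH y)
                F (alphaH x) y' z).
  rewrite tsum_natR; last by multilin.
  apply: eq_tsum => x y; rewrite tsum_natQ; last by multilin.
  rewrite (tsum_comul_linv bialgH); last by multilin.
  by apply: eq_tsum => y' z; rewrite /F lfunK.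
rewrite -(tsum_coassoc bialgH); [|by rewrite /F; multilin..].
rewrite tsum_natQ; last by multilin.
apply: eq_tsum => x z; rewrite tsum_natR; last by multilin.
rewrite (tsum_comul_linv bialgH); last by multilin.
by apply: eq_tsum => x' y; rewrite /F lfunK.
Qed.

Lemma natR_alpha d h : tmap alphaD alphaH (R (h ⊗ d)) = R (alphaH h ⊗ alphaD d).
Proof.
rewrite !natRE linear_tsum (tsum_comul_alpha bialgH); last by multilin.
by apply: eq_tsum => x y; rewrite /= tmapE lact_alpha !(lfunK, linvK).
Qed.

Lemma natQ_alpha d h : tmap alphaD alphaH (Q (d ⊗ h)) = Q (alphaD d ⊗ alphaH h).
Proof.
rewrite !natQE linear_tsum (tsum_comul_alpha bialgH); last by multilin.
by apply: eq_tsum => x y; rewrite /= tmapE ract_alpha !(lfunK, linvK).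
Qed.

Lemma LR_twisting_natural : LR_twisting muD alphaD muH alphaH R Q.
Proof.
split=> *; [exact: natR_alpha|exact: natQ_alpha|exact: natR_mulD|
  exact: natR_mulH|exact: natQ_mulD|exact: natQ_mulH|exact: natR_natQ_HDH|
  exact: natR_natQ_DHD].
Qed.

Lemma LR_mul_naturalE d h d' h' :
  LR_mul muD muH R Q ((d ⊗ h) ⊗ (d' ⊗ h')) =
  \tsum_(h1 ⊗ h2 <- DeltaH h) \tsum_(h'1 ⊗ h'2 <- DeltaH h')
    muD (ract (aDi d ⊗ aHi (aHi h'2)) ⊗ lact (aHi (aHi h1) ⊗ aDi d'))
    ⊗ aHi (muH (h2 ⊗ h'1)).
Proof.
rewrite LR_mulE tsum_natQ; last by multilin.
rewrite [RHS]exchange_tsum; apply: eq_tsum => x' y'.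
rewrite tsum_natR; last by multilin.
by apply: eq_tsum => x y; rewrite aHiM.
Qed.

End NaturalTwisting.

Theorem theorem3p6 (k : fieldType)
    (H : lmodType k) (muH : {linear H ⨂ H -> H})
    (DeltaH : {linear H -> H ⨂ H}) (alphaH : {linear H -> H})
    (D : lmodType k) (muD : {linear D ⨂ D -> D}) (alphaD : {linear D -> D})
    (lact : {linear H ⨂ D -> D}) (ract : {linear D ⨂ H -> D})
    (bialgH : hom_bialgebra muH DeltaH alphaH)
    (algD : bimodule_hom_algebra muH DeltaH alphaH muD alphaD lact ract)
    (bijD : bijective alphaD) (bijH : bijective alphaH) :
  let R : {linear H ⨂ D -> D ⨂ H} := natR DeltaH lact bijH bijD in
  let Q : {linear D ⨂ H -> D ⨂ H} := natQ DeltaH ract bijH bijD in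
  let mulDH : {linear (D ⨂ H) ⨂ (D ⨂ H) -> D ⨂ H} := LR_mul muD muH R Q in
  [/\ LR_twisting muD alphaD muH alphaH R Q,
      hom_associative mulDH (tmap alphaD alphaH)
    & forall (d : D) (h : H) (d' : D) (h' : H),
        mulDH ((d ⊗ h) ⊗ (d' ⊗ h')) =
        \tsum_(h1 ⊗ h2 <- DeltaH h) \tsum_(h'1 ⊗ h'2 <- DeltaH h')
          muD (ract (linv bijD d ⊗ linv bijH (linv bijH h'2))
               ⊗ lact (linv bijH (linv bijH h1) ⊗ linv bijD d'))
          ⊗ linv bijH (muH (h2 ⊗ h'1))].
Proof.
move=> R Q mulDH; have twRQ := LR_twisting_natural bialgH algD bijD bijH.
split; first exact: twRQ.
- exact: hom_associative_LR_mul (bha_assoc algD) (hom_bialg_assoc bialgH) twRQ.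
- exact: (LR_mul_naturalE _ _ _ bialgH).
Qed.
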